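(* Let $s,t>0$. For all $\theta\in(0,1)$, the product probability measure on $\mathbb N^2$ with both marginals equal to $\nu^{s+t}_\theta$ is reversible for the process with generator $\mathcal L$.
   Context: $\mathbb N=\{0,1,2,\dots\}$; $B(s,t)=\Gamma(s)\Gamma(t)/\Gamma(s+t)$. $\nu^{s+t}_\theta$ is the discrete Gamma distribution on $\mathbb N$, $$\nu^{s+t}_\theta(n)=\frac{1}{Z_\theta}\,\frac{\theta^n}{n!}\,\frac{\Gamma(s+t+n)}{\Gamma(s+t)},\qquad Z_\theta=(1-\theta)^{-s-t}.$$ $\mathcal L$ is the generator of the continuous-time Markov chain on $\mathbb N^2$ given by $$\mathcal Lf(n,m)=\sum_{k=0}^n\sum_{l=0}^mr_{s,t}(n,m;k,l)\big(f(n-k+l,\;m-l+k)-f(n,m)\big),$$ $$r_{s,t}(n,m;k,l)=\frac{n!\,m!}{B(s,t)^2}\,\frac{\Gamma(k+s)\,\Gamma(m-l+t)\,\Gamma(n-k+t)\,\Gamma(l+s)}{\Gamma(s+t+n)\,\Gamma(s+t+m)\,(n-k)!\,k!\,(m-l)!\,l!}.$$ *)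

(* Defs.v *)
From HB Require Import structures.
From mathcomp Require Import all_boot all_order all_algebra.
From mathcomp Require Import all_classical all_reals all_analysis.

Set Implicit Arguments.
Unset Strict Implicit.
Unset Printing Implicit Defensive.

Import Order.TTheory GRing.Theory Num.Theory.
Import numFieldNormedType.Exports.

Local Open Scope classical_set_scope.
Local Open Scope ring_scope.

Section GammaBeta.
Context {R : realType}.

Definition Gamma (x : R) : R :=
  \int[lebesgue_measure]_(y in `]0, +oo[) (y `^ (x - 1) * expR (- y)).

Definition Beta (s t : R) : R := Gamma s * Gamma t / Gamma (s + t).

Definition discrete_gamma_pmf (a theta : R) (n : nat) : R :=
  ((1 - theta) `^ (- a))^-1
    * (theta ^+ n / n`!%:R * (Gamma (a + n%:R) / Gamma a)).

(* All truncated subtractions below are used only for k <= n and l <= m. *)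
Definition rate (s t : R) (n m k l : nat) : R :=
  n`!%:R * m`!%:R / Beta s t ^+ 2
  * (Gamma (k%:R + s) * Gamma ((m - l)%:R + t)
       * Gamma ((n - k)%:R + t) * Gamma (l%:R + s)
     / (Gamma (s + t + n%:R) * Gamma (s + t + m%:R)
          * (n - k)`!%:R * k`!%:R * (m - l)`!%:R * l`!%:R)).

Definition generator (s t : R) (f : nat * nat -> R) (x : nat * nat) : R :=
  let: (n, m) := x in
  \sum_(k < n.+1) \sum_(l < m.+1)
    rate s t n m k l * (f ((n - k + l)%N, (m - l + k)%N) - f (n, m)).

End GammaBeta.

(* A Markov process enters through its transition kernels: P u x A is the
   probability of being in A at time u when starting from x. Only the times
   u >= 0 are relevant. *)
Section MarkovProcess.
Context {d : measure_display} {X : measurableType d} {R : realType}.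
Implicit Types (P : R -> R.-pker X ~> X) (f g : X -> R).

Definition transition_semigroup P : Prop :=
  (forall x A, measurable A -> P 0 x A = \d_x A) /\
  (forall u v x A, 0 <= u -> 0 <= v -> measurable A ->
     P (u + v) x A = (\int[P u x]_y P v y A)%E).

Definition semigroup_op P (u : R) f (x : X) : R := \int[P u x]_y f y.

Definition bounded_measurable f : Prop :=
  measurable_fun [set: X] f /\ bounded_fun f.

(* Defined on all bounded functions: this is the notion for bounded
   generators, such as that of a Markov chain with bounded jump rates. *)
Definition has_generator P (L : (X -> R) -> X -> R) : Prop :=
  forall f, bounded_measurable f -> forall x,
    (semigroup_op P u f x - f x) / u @[u --> 0^'+] --> L f x.

Definition reversible (mu : {measure set X -> \bar R}) P : Prop :=
  forall u f g, 0 <= u -> bounded_measurable f -> bounded_measurable g ->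
    \int[mu]_x (f x * semigroup_op P u g x) =
    \int[mu]_x (semigroup_op P u f x * g x).

End MarkovProcess.

(* Main.v *)
(** Write [P_u] for the semigroup and [<f, g>] for the scalar product weighted
by the stationary weights on a level [{n + m = N}], a finite set closed under
the jumps.

The weight of [(n, m)] times the rate [(n, m; k, l)] depends only on
[(k, n - k, l, m - l)] and is symmetric in [k] and [l], and the jump exchanges
[k] and [l]: this is detailed balance on each level. Hence
[A_h(f, g) = <P_h f, g> - <f, P_h g>] is [o(h)] uniformly over [f] and [g]
bounded by given constants, because on a finite closed set it is controlled by
finitely many transition probabilities. Since
[A_(u+h)(f, g) = A_u(P_h f, g) + A_h(f, P_u g)], cutting [u] into [k] pieces
gives [A_u = k * o(u / k)], so [A_u = 0] on every level, and summing over the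
levels gives reversibility. Neither regularity in time nor uniqueness for the
Kolmogorov equations is used.

That the discrete Gamma weights sum to [1] follows by expanding [exp (theta y)]
in the integral of [y^(a-1) exp (- (1 - theta) y)]. *)

Require Import Defs.
From HB Require Import structures.
From mathcomp Require Import all_boot all_order all_algebra.
From mathcomp Require Import all_classical all_reals all_analysis.
From mathcomp Require Import measurable_realfun ring lra zify.
Import Order.TTheory GRing.Theory Num.Theory.
Import numFieldNormedType.Exports.
Local Open Scope classical_set_scope.
Local Open Scope ring_scope.

Set Implicit Arguments.
Unset Strict Implicit.
Unset Printing Implicit Defensive.

(** * The Gamma integral *)

Section GammaFunction.
Context {R : realType}.
Implicit Types (x y c : R).
Local Notation mu := (@lebesgue_measure R).

(** Lebesgue measure is [c] times its image under multiplication by [c]: the two agree on half-open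
    intervals, hence everywhere by uniqueness. The formula is then the change of variables for an
    image measure. *)
Lemma ge0_integration_scale c (f : R -> \bar R) : 0 < c ->
  measurable_fun [set: R] f -> (forall x, (0 < x)%R -> 0 <= f x)%E ->
  (c%:E * \int[mu]_(x in `]0%R, +oo[) f (c * x)%R =
   \int[mu]_(x in `]0%R, +oo[) f x)%E.
Proof.
move=> c0 mf f0.
pose c_ : measurableTypeR R -> measurableTypeR R := *%R c.
have mc : measurable_fun [set: measurableTypeR R] c_ by exact: mulrl_measurable.
pose nu := measure_function_pushforward__canonical__measure_function_Measure
  mu mc.
have muE (A : set (measurableTypeR R)) : measurable A ->
    mscale (NngNum (ltW c0)) nu A = mu A.
  move=> mA; apply/esym/lebesgue_measure_unique => //=.
  move=> _ [[a b]] _ <-.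
  have pE : c_ @^-1` `]a, b] = `](a / c), (b / c)]%classic.
    by apply/seteqP; split => z /=;
      rewrite /c_ !in_itv/= ltr_pdivrMr// ler_pdivlMr// (mulrC z).
  transitivity (c%:E * mu (c_ @^-1` `]a, b]))%E; last by [].
  rewrite pE !lebesgue_measure_itv/= !lte_fin ltr_pM2r ?invr_gt0//.
  case: ifPn => _; last by rewrite mule0.
  by rewrite -!EFinD -EFinM -mulrBl mulrC divfK// gt_eqF.
have E0 : `]0, +oo[%classic = c_ @^-1` `]0, +oo[%classic.
  by apply/seteqP; split => z /=; rewrite /c_ !in_itv/= !andbT pmulr_rgt0.
transitivity (c%:E * \int[mu]_(x in c_ @^-1` `]0%R, +oo[) (f \o c_) x)%E.
  by rewrite -E0.
rewrite -(ge0_integral_pushforward mc mu)//; last 2 first.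
- exact: measurable_funTS.
- by move=> y; rewrite inE/= in_itv/= andbT; exact: f0.
have mD : measurable (`]0%R, +oo[%classic : set (measurableTypeR R)) by [].
have f0' y : `]0%R, +oo[%classic y -> (0 <= f y)%E.
  by rewrite /= in_itv/= andbT; exact: f0.
transitivity (\int[mscale (NngNum (ltW c0)) nu]_(x in `]0%R, +oo[) f x)%E.
  by apply/esym/ge0_integral_mscale => //; exact: measurable_funTS.
by apply: eq_measure_integral => A mA _; exact: muE.
Qed.

(** Unnormalised: for [x > 0] its integral over the positive half-line is [Gamma x], not 1. *)
Definition gamma_pdf x y : R := y `^ (x - 1) * expR (- y).

Lemma gamma_pdf_ge0 x y : 0 <= gamma_pdf x y.
Proof. by rewrite mulr_ge0 ?powR_ge0 ?expR_ge0. Qed.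

Lemma measurable_gamma_pdf x D : measurable_fun D (gamma_pdf x).
Proof.
apply: measurable_funTS; apply: measurable_funM.
  exact: measurable_powR.
by apply: measurableT_comp => //; exact: oppr_measurable.
Qed.

Lemma integral_powR_unit_le x : 0 < x ->
  (\int[mu]_(y in `]0%R, 1%R]) (y `^ (x - 1))%:E <= (x^-1)%:E)%E.
Proof.
move=> x0.
(* With [i.+2] the left endpoint is strictly below 1 already for [i = 0], as the fundamental theorem
   of calculus requires. *)
pose F (i : nat) : set (measurableTypeR R) := `[(i.+2%:R^-1 : R), 1%R]%classic.
have -> : `]0%R, 1%R]%classic = \bigcup_i F i.
  apply/seteqP; split => y /=.
    rewrite in_itv/= => /andP[y0 y1].
    exists (Num.trunc y^-1) => //=; rewrite /F/= in_itv/= y1 andbT.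
    rewrite -[leRHS]invrK lef_pV2 ?posrE ?invr_gt0//.
    rewrite (le_trans (ltW (truncnS_gt _)))// ler_nat//.
  move=> [i _]; rewrite /F/= !in_itv/= => /andP[yi ->]; rewrite andbT.
  by rewrite (lt_le_trans _ yi)// invr_gt0.
have mF i : measurable (F i) by exact: measurable_itv.
have ndF : nondecreasing_seq F.
  apply/nondecreasing_seqP => i; rewrite subsetEset => y /=.
  rewrite /F/= !in_itv/= => /andP[yi ->]; rewrite andbT (le_trans _ yi)//.
  by rewrite lef_pV2 ?posrE// ler_nat.
have mp D : measurable_fun D (fun y : R => (y `^ (x - 1))%:E).
  by apply/measurable_EFinP/measurable_funTS; exact: measurable_powR.
have := @ge0_nondecreasing_set_cvg_integral _ _ _ F
  (fun y => (y `^ (x - 1))%:E) mu ndF mF (fun _ => mp _)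
  (fun _ y _ => powR_ge0 y (x - 1)).
move=> /cvg_lim => <- //. apply: lime_le.
  apply: ereal_nondecreasing_is_cvgn.
  apply: ge0_nondecreasing_set_nondecreasing_integral => // [i|i y _].
    exact: mp.
  by rewrite lee_fin powR_ge0.
apply: nearW => i; rewrite /F.
have a0 : 0 < (i.+2%:R^-1 : R) by rewrite invr_gt0.
have a1 : (i.+2%:R^-1 : R) < 1 by rewrite invf_lt1 ?ltr1n// ltr0n.
have cpow z p : 0 < z -> {for z, continuous (fun y : R => y `^ p)}.
  move=> z0; apply: differentiable_continuous; apply/derivable1_diffP.
  by apply: derivable_powR; rewrite in_itv/= andbT.
rewrite (@continuous_FTC2 _ _ (fun y => x^-1 * y `^ x))//.
- rewrite powR1 mulr1 -EFinD lee_fin lerBlDr lerDl.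
  by rewrite mulr_ge0 ?powR_ge0// invr_ge0 ltW.
- apply: continuous_in_subspaceT => z; rewrite inE/= in_itv/= => /andP[az _].
  by apply: cpow; exact: lt_le_trans az.
- split.
  + move=> z; rewrite in_itv/= => /andP[az _].
    apply: derivableM => //; apply: derivable_powR.
    by rewrite in_itv/= andbT (lt_trans a0).
  + apply: cvg_at_right_filter; apply: cvgM; first exact: cvg_cst.
    exact: cpow.
  + apply: cvg_at_left_filter; apply: cvgM; first exact: cvg_cst.
    exact: cpow.
- move=> z; rewrite in_itv/= => /andP[az _].
  have z0 : 0 < z by exact: lt_trans az.
  have dz : is_derive z 1 (fun y => x^-1 * y `^ x) (x^-1 *: (x * z `^ (x - 1))).
    by apply: is_deriveZ; exact: is_derive1_powR.
  rewrite derive1E (@derive_val _ _ _ _ _ _ _ dz) /GRing.scale/= mulKf//.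
  by rewrite gt_eqF.
Qed.

Lemma gamma_pdf_exp_bound x : exists2 C, 0 <= C &
  forall y, 1 <= y -> gamma_pdf x y <= C * expR (- (2^-1) * y).
Proof.
pose n := (Num.trunc `|x - 1|).+1.
exists (2 ^+ n * n`!%:R); first by rewrite mulr_ge0// exprn_ge0.
move=> y y1; have y0 : 0 < y by exact: lt_le_trans y1.
rewrite /gamma_pdf.
have -> : - y = - (2^-1 * y) + - 2^-1 * y by lra.
rewrite expRD mulrA ler_pM2r ?expR_gt0//.
rewrite expRN ler_pdivrMr ?expR_gt0//.
have : y `^ (x - 1) <= y ^+ n.
  rewrite -powR_mulrn ?(ltW y0)// ler_powR// (le_trans (ler_norm _))//.
  exact/ltW/truncnS_gt.
move=> /le_trans; apply.
have := @expR_ge1Dxn _ (2^-1 * y) n.-1; rewrite mulr_ge0 ?invr_ge0 ?(ltW y0)//.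
move=> /(_ isT) h.
have {}h : (2^-1 * y) ^+ n / n`!%:R <= expR (2^-1 * y).
  by apply: le_trans h; rewrite lerDr.
rewrite ler_pdivrMr ?ltr0n ?fact_gt0// in h.
rewrite -mulrA -ler_pdivrMl ?exprn_gt0// -exprVn -exprMn.
by rewrite (le_trans h)// mulrC.
Qed.

(** The half-line is cut at 1: the power dominates on the left, and a multiple of the exponential
    density of rate 1/2 on the right. *)
Lemma integral_gamma_pdf_lty x : 0 < x ->
  (\int[mu]_(y in `]0%R, +oo[) (gamma_pdf x y)%:E < +oo)%E.
Proof.
move=> x0.
have -> : `]0%R, +oo[%classic = `]0%R, 1%R] `|` `]1%R, +oo[ :> set R.
  apply/seteqP; split => y /=; rewrite !in_itv/= !andbT.
    by move=> ->; case: leP; [left|right].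
  by move=> [/andP[]//|]; exact: lt_trans.
have mE D : measurable_fun D (fun y => (gamma_pdf x y)%:E).
  by apply/measurable_EFinP; exact: measurable_gamma_pdf.
rewrite ge0_integral_setU//; last 3 first.
- exact: mE.
- by move=> y _; rewrite lee_fin gamma_pdf_ge0.
- apply/disj_set2P/seteqP; split => // y [/=]; rewrite !in_itv/= => /andP[_ y1].
  by rewrite ltNge y1.
apply: lte_add_pinfty.
  apply: le_lt_trans (ltry x^-1).
  apply: le_trans (integral_powR_unit_le x0).
  apply: ge0_le_integral => //.
  - by move=> y _; rewrite lee_fin gamma_pdf_ge0.
  - exact: mE.
  - by apply/measurable_EFinP/measurable_funTS; exact: measurable_powR.
  - move=> y /=; rewrite in_itv/= => /andP[y0 _].
    by rewrite lee_fin ler_piMr ?powR_ge0// expR_le1 oppr_le0 ltW.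
have [C C0 hC] := gamma_pdf_exp_bound x.
have r0 : (0 : R) < 2^-1 by [].
(* The exponential density of rate 1/2 carries a factor 1/2, which the 2 in [C * 2] compensates. *)
apply: (@le_lt_trans _ _
  (\int[mu]_y ((C * 2)%:E * (exponential_pdf 2^-1 y)%:E))%E).
  rewrite integral_mkcond/=; apply: ge0_le_integral => //.
  - move=> y _; rewrite patchE; case: ifP => // _.
    by rewrite lee_fin gamma_pdf_ge0.
  - by apply/(measurable_restrictT _ _).1 => //; exact: mE.
  - apply: measurable_funeM; apply/measurable_EFinP.
    exact: measurable_exponential_pdf.
  - move=> y _; rewrite patchE; case: ifPn; last first.
      by move=> _; rewrite mule_ge0// lee_fin ?mulr_ge0 ?exponential_pdf_ge0.
    rewrite inE/= in_itv/= andbT => y1.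
    rewrite exponential_pdfE ?(le_trans _ (ltW y1))// -EFinM lee_fin.
    rewrite mulrA mulfK//; apply: hC; exact: ltW.
rewrite ge0_integralZl//; last 3 first.
- by apply/measurable_EFinP; exact: measurable_exponential_pdf.
- by move=> y _; rewrite lee_fin exponential_pdf_ge0.
- by rewrite lee_fin mulr_ge0.
by rewrite integral_exponential_pdf// mule1 ltry.
Qed.

(** [Gamma] is the [fine] part of an extended integral and would be 0 if that integral were
    infinite; finiteness makes it faithful. *)
Lemma GammaE x : 0 < x ->
  (Gamma x)%:E = (\int[mu]_(y in `]0%R, +oo[) (gamma_pdf x y)%:E)%E.
Proof.
move=> x0; rewrite /Gamma /Rintegral fineK// ge0_fin_numE.
  exact: integral_gamma_pdf_lty.
by apply: integral_ge0 => y _; rewrite lee_fin gamma_pdf_ge0.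
Qed.

(** If the integral vanished, the integrand would be zero almost everywhere, but it is nonzero on a
    half-line of infinite measure. *)
Lemma Gamma_gt0 x : 0 < x -> 0 < Gamma x.
Proof.
move=> x0; rewrite -lte_fin GammaE//.
rewrite lt_neqAle; apply/andP; split; last first.
  by apply: integral_ge0 => y _; rewrite lee_fin gamma_pdf_ge0.
apply/negP => /eqP/esym I0.
have mE D : measurable_fun D (fun y => (gamma_pdf x y)%:E).
  by apply/measurable_EFinP; exact: measurable_gamma_pdf.
have mD : measurable (`]0%R, +oo[%classic : set (measurableTypeR R)) by [].
have [+ _] := ae_eq_integral_abs mu mD (mE _).
under eq_integral do rewrite gee0_abs ?lee_fin ?gamma_pdf_ge0//.
move=> /(_ I0) [N [mN N0 DN]].
have : (mu `]0%R, +oo[ <= mu N)%E.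
  apply: le_measure; rewrite ?inE// => y Dy; apply: DN => /= /(_ Dy) /eqP.
  move: Dy; rewrite /= in_itv/= andbT => y0.
  by rewrite eqe mulf_eq0 expR_eq0 orbF powR_eq0 gt_eqF.
by rewrite N0 lebesgue_measure_itv/= ltry.
Qed.

End GammaFunction.

(** * The discrete Gamma distribution *)

Section DiscreteGamma.
Context {R : realType}.
Local Notation mu := (@lebesgue_measure R).

Lemma expR_eseries (x : R) : 0 <= x ->
  (\sum_(0 <= n <oo) (x ^+ n / n`!%:R)%:E)%E = (expR x)%:E.
Proof.
move=> x0; rewrite expRE -EFin_lim; last first.
  rewrite /pseries/=; under eq_fun do rewrite mulrC.
  exact: is_cvg_series_exp_coeff.
apply/congr_lim/funext => n/=; rewrite /pseries/= /series/= -sumEFin//.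
by under eq_bigr do rewrite mulrC.
Qed.

(* Expanding [exp (theta y)] under the integral of
   [y^(a-1) exp (- (1 - theta) y)]. *)
Lemma Gamma_eseries (a theta : R) : 0 < a -> 0 < theta < 1 ->
  (\sum_(0 <= n <oo) (theta ^+ n / n`!%:R * Gamma (a + n%:R))%:E)%E =
  ((1 - theta) `^ (- a) * Gamma a)%:E.
Proof.
move=> a0 /andP[t0 t1].
have c0 : 0 < 1 - theta by rewrite subr_gt0.
have tn0 n : 0 <= theta ^+ n / n`!%:R by rewrite divr_ge0// exprn_ge0// ltW.
have mE x D : measurable_fun D (fun y : R => (gamma_pdf x y)%:E).
  by apply/measurable_EFinP; exact: measurable_gamma_pdf.
transitivity (\sum_(0 <= n <oo) \int[mu]_(y in `]0%R, +oo[)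
    ((theta ^+ n / n`!%:R)%:E * (gamma_pdf (a + n%:R) y)%:E))%E.
  apply: eq_eseriesr => n _.
  rewrite EFinM GammaE ?ltr_wpDr// ge0_integralZl//.
  - exact: mE.
  - by move=> y _; rewrite lee_fin gamma_pdf_ge0.
  - by rewrite lee_fin.
transitivity (\int[mu]_(y in `]0%R, +oo[) \sum_(0 <= n <oo)
    ((theta ^+ n / n`!%:R)%:E * (gamma_pdf (a + n%:R) y)%:E))%E.
  apply/esym/integral_nneseries => //.
    by move=> n; apply: measurable_funeM; exact: mE.
  by move=> n y _; rewrite -EFinM lee_fin mulr_ge0// gamma_pdf_ge0.
(* The factor [(1 - theta)]^ (1 - a)[turns]y [^ (a - 1)] into a power of [(1 - theta) * y], so that
   the scaling lemma applies. *)
transitivity (\int[mu]_(y in `]0%R, +oo[)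
    (((1 - theta) `^ (1 - a))%:E * (gamma_pdf a ((1 - theta) * y))%:E))%E.
  apply: eq_integral => y; rewrite inE/= in_itv/= andbT => y0.
  transitivity (\sum_(0 <= n <oo)
      ((gamma_pdf a y)%:E * ((theta * y) ^+ n / n`!%:R)%:E))%E.
    apply: eq_eseriesr => n _; rewrite -!EFinM; congr EFin.
    rewrite /gamma_pdf addrAC [y `^ (a - 1 + _)]powRD ?(gt_eqF y0) ?implybT//.
    by rewrite powR_mulrn ?(ltW y0)// exprMn; ring.
  rewrite (@nneseriesZl _ (fun n => ((theta * y) ^+ n / n`!%:R)%:E)
    xpredT); last first.
    by move=> n _; rewrite lee_fin divr_ge0// exprn_ge0// mulr_ge0// ltW.
  rewrite expR_eseries ?mulr_ge0 ?ltW// -!EFinM; congr EFin.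
  rewrite /gamma_pdf powRM ?(ltW c0) ?(ltW y0)// -[LHS]mulrA -expRD !mulrA.
  rewrite -powRD ?(gt_eqF c0) ?implybT//.
  have -> : 1 - a + (a - 1) = 0 by ring.
  rewrite powRr0 mul1r.
  by congr (_ * expR _); ring.
rewrite ge0_integralZl//; last 3 first.
- apply/measurable_EFinP; apply: measurable_funTS.
  apply: (@measurableT_comp _ _ _ _ _ _ (gamma_pdf a) _ ( *%R (1 - theta))).
    exact: measurable_gamma_pdf.
  exact: mulrl_measurable.
- by move=> y _; rewrite lee_fin gamma_pdf_ge0.
- by rewrite lee_fin powR_ge0.
have := ge0_integration_scale c0 (mE a setT)
  (fun y _ => gamma_pdf_ge0 a y : (0 <= (gamma_pdf a y)%:E)%E).
rewrite -GammaE// => h; rewrite [RHS]EFinM -h muleA; congr (_ * _)%E.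
rewrite -EFinM; congr EFin.
rewrite -[X in _ = _ * X]powRr1 ?ltW// -powRD ?(gt_eqF c0) ?implybT//.
by congr powR; ring.
Qed.

Lemma discrete_gamma_pmf_ge0 (a theta : R) n : 0 < a -> 0 < theta < 1 ->
  0 <= discrete_gamma_pmf a theta n.
Proof.
move=> a0 /andP[t0 t1]; rewrite mulr_ge0// ?invr_ge0 ?powR_ge0// mulr_ge0//.
  by rewrite divr_ge0// exprn_ge0// ltW.
by rewrite divr_ge0// ltW// Gamma_gt0// ltr_wpDr.
Qed.

Lemma discrete_gamma_pmf_sum (a theta : R) : 0 < a -> 0 < theta < 1 ->
  (\sum_(0 <= n <oo) (discrete_gamma_pmf a theta n)%:E = 1)%E.
Proof.
move=> a0 t01; have /andP[t0 t1] := t01.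
have Z0 : 0 < (1 - theta) `^ (- a) by rewrite powR_gt0 ?subr_gt0.
have G0 := Gamma_gt0 a0.
transitivity (\sum_(0 <= n <oo) ((((1 - theta) `^ (- a) * Gamma a)^-1)%:E
   * (theta ^+ n / n`!%:R * Gamma (a + n%:R))%:E))%E.
  apply: eq_eseriesr => n _; rewrite -EFinM; congr EFin.
  by rewrite /discrete_gamma_pmf invfM; ring.
rewrite (@nneseriesZl _ (fun n => (theta ^+ n / n`!%:R * Gamma (a + n%:R))%:E)
  xpredT); last first.
  move=> n _; rewrite lee_fin mulr_ge0 ?divr_ge0 ?exprn_ge0 ?ltW//.
  by rewrite Gamma_gt0// ltr_wpDr.
by rewrite Gamma_eseries// -EFinM mulVf// mulf_neq0// gt_eqF.
Qed.

(** The measure of [U] is the unordered sum of [p] over [U]; countable additivity is the regrouping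
    of a nonnegative family along a disjoint union. *)
Lemma probability_of_pmf (p : nat -> R) : (forall n, 0 <= p n) ->
  (\sum_(0 <= n <oo) (p n)%:E = 1)%E ->
  exists nu : probability nat R, forall n, nu [set n] = (p n)%:E.
Proof.
move=> p0 p1; pose m (U : set nat) := (\esum_(k in U) (p k)%:E)%E.
have m0 : m set0 = 0%E by rewrite /m esum_set0.
have m_ge0 U : (0 <= m U)%E by apply: esum_ge0 => n _; rewrite lee_fin.
have m_sigma : semi_sigma_additive m.
  move=> F mF tF mUF; apply: cvg_toP.
    apply: ereal_nondecreasing_is_cvgn => a b ab.
    exact: lee_sum_nneg_natr.
  by rewrite /m nneseries_sum_bigcup// => i; rewrite lee_fin.
pose mm := isMeasure.Build _ _ _ m m0 m_ge0 m_sigma.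
pose M : {measure set nat -> \bar R} := HB.pack m mm.
have MT : M setT = 1%E.
  rewrite /M/= /m -nneseries_esumT// => n; by rewrite lee_fin.
pose pm := @Measure_isProbability.Build _ _ R M MT.
pose P : probability nat R := HB.pack m mm pm.
by exists P => n; rewrite /P/= /m esum_set1// lee_fin.
Qed.

End DiscreteGamma.

(** * Semigroup operators *)

Section SemigroupOperators.
Context {d : measure_display} {X : measurableType d} {R : realType}.
Variable P : R -> R.-pker X ~> X.
Implicit Types (f g : X -> R) (M u v : R) (x : X).

(** The bound is a parameter, since the later estimates must be uniform over all functions with
    given bounds. *)
Definition bounded_measurable_by M f :=
  measurable_fun [set: X] f /\ forall x, `|f x| <= M.

Lemma bounded_measurableP f :
  bounded_measurable f <-> exists M, bounded_measurable_by M f.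
Proof.
split=> [[mf [M [_ fM]]]|[M [mf fM]]].
  (* [bounded_fun] only provides the bounds strictly above [M]. *)
  by exists (M + 1); split => // x; apply: (fM (M + 1)) => //; rewrite ltrDl.
split=> //; exists M; split; first exact: num_real.
by move=> y My x _; apply: le_trans (fM x) _; exact: ltW.
Qed.

Lemma bounded_measurable_by_ge0 M f x : bounded_measurable_by M f -> 0 <= M.
Proof. by move=> [_ /(_ x)]; exact: le_trans. Qed.

Lemma pker_integrable M f u x :
  bounded_measurable_by M f -> (P u x).-integrable [set: X] (EFin \o f).
Proof.
move=> bf; have [mf bf'] : bounded_measurable f.
  by apply/bounded_measurableP; exists M.
apply: measurable_bounded_integrable => //.
by rewrite prob_kernel ltry.
Qed.

Lemma bounded_measurable_byD M N f g : bounded_measurable_by M f ->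
  bounded_measurable_by N g ->
  bounded_measurable_by (M + N) (fun x => f x + g x).
Proof.
move=> [mf fM] [mg gN]; split; first exact: measurable_funD.
by move=> x; rewrite (le_trans (ler_normD _ _))// lerD.
Qed.

Lemma bounded_measurable_byM M N f g : bounded_measurable_by M f ->
  bounded_measurable_by N g ->
  bounded_measurable_by (M * N) (fun x => f x * g x).
Proof.
move=> [mf fM] [mg gN]; split; first exact: measurable_funM.
by move=> x; rewrite normrM ler_pM.
Qed.

Lemma bounded_measurable_by_cst (c : R) :
  bounded_measurable_by `|c| (fun _ : X => c).
Proof. by split => //; exact: measurable_cst. Qed.

Lemma bounded_measurable_by_indic (A : set X) :
  measurable A -> bounded_measurable_by 1 (\1_A : X -> R).
Proof.
move=> mA; split; first exact: measurable_indic.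
by move=> x; rewrite indicE; case: (_ \in _); rewrite ?normr1 ?normr0.
Qed.

Lemma semigroup_opD M N f g u x : bounded_measurable_by M f ->
  bounded_measurable_by N g ->
  semigroup_op P u (fun y => f y + g y) x =
  semigroup_op P u f x + semigroup_op P u g x.
Proof.
move=> bf bg; apply: RintegralD => //.
  exact: pker_integrable bf.
exact: pker_integrable bg.
Qed.

Lemma semigroup_opZ M f (c : R) u x : bounded_measurable_by M f ->
  semigroup_op P u (fun y => c * f y) x = c * semigroup_op P u f x.
Proof. by move=> bf; apply: RintegralZl => //; exact: pker_integrable bf. Qed.

Lemma semigroup_op_cst (c : R) u x : semigroup_op P u (fun _ => c) x = c.
Proof.
by rewrite /semigroup_op Rintegral_cst// prob_kernel mulr1.
Qed.

Lemma semigroup_op_norm_le M N f g u x : bounded_measurable_by M f ->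
  bounded_measurable_by N g -> (forall y, `|f y| <= g y) ->
  `|semigroup_op P u f x| <= semigroup_op P u g x.
Proof.
move=> bf bg fg.
rewrite (le_trans (le_normr_Rintegral measurableT (pker_integrable u x bf)))//.
apply: le_Rintegral => //; last exact: pker_integrable bg.
apply: (@pker_integrable M (fun y => `|f y|)).
have [mf fM] := bf; split; first exact: measurableT_comp.
by move=> y; rewrite normr_id.
Qed.

(** Adding the constant [M] reduces to a nonnegative integrand, for which kernel integrals are
    measurable in the starting point. *)
Lemma measurable_semigroup_op M f u : bounded_measurable_by M f ->
  measurable_fun [set: X] (semigroup_op P u f).
Proof.
move=> bf.
have bfM : bounded_measurable_by (M + `|M|) (fun y => f y + M).
  by apply: bounded_measurable_byD => //; exact: bounded_measurable_by_cst.
have -> : semigroup_op P u f =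
    fun x => semigroup_op P u (fun y => f y + M) x - M.
  apply/funext => x.
  rewrite (semigroup_opD _ _ bf (bounded_measurable_by_cst M)).
  by rewrite semigroup_op_cst addrK.
apply: measurable_funB => //; apply: measurableT_comp => //.
apply: measurable_fun_integral_kernel.
- by move=> U mU; exact: measurable_kernel.
- move=> z; rewrite lee_fin -lerBlDr sub0r.
  by have [_ /(_ z)] := bf; rewrite ler_norml => /andP[].
- by apply/measurable_EFinP; case: bfM.
Qed.

(** The kernels are probabilities, so the bound does not grow; this keeps the constants fixed when
    short times are iterated. *)
Lemma bounded_semigroup_op M f u : bounded_measurable_by M f ->
  bounded_measurable_by M (semigroup_op P u f).
Proof.
move=> bf; split; first exact: measurable_semigroup_op bf.
move=> x; rewrite -[leRHS](semigroup_op_cst M u x).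
apply: (semigroup_op_norm_le _ _ bf (bounded_measurable_by_cst M)).
by case: bf.
Qed.

Hypothesis SP : transition_semigroup P.

Lemma semigroup_op0 f x :
  measurable_fun [set: X] f -> semigroup_op P 0 f x = f x.
Proof.
move=> mf; rewrite /semigroup_op /Rintegral.
rewrite (@eq_measure_integral _ _ _ _ (\d_x)); last first.
  by move=> A mA _; exact: SP.1.
rewrite integral_dirac//; last exact/measurable_EFinP.
by rewrite diracT mul1e.
Qed.

(** The semigroup property on sets identifies [P (u + v) x] with a composed kernel, whose integral
    of a nonnegative function is an iterated integral. A shift by [M] gives the bounded case. *)
Lemma semigroup_op_comp M f u v x : 0 <= u -> 0 <= v ->
  bounded_measurable_by M f ->
  semigroup_op P (u + v) f x = semigroup_op P u (semigroup_op P v f) x.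
Proof.
move=> u0 v0 bf.
have bM := bounded_measurable_by_cst M.
wlog f0 : f M bf bM / forall y, 0 <= f y.
  move=> H.
  have bfM : bounded_measurable_by (M + `|M|) (fun y => f y + M).
    exact: bounded_measurable_byD.
  have /(H _ _ bfM (bounded_measurable_by_cst _)) : forall y, 0 <= f y + M.
    move=> z; rewrite -lerBlDr sub0r.
    by have [_ /(_ z)] := bf; rewrite ler_norml => /andP[].
  rewrite (semigroup_opD _ _ bf bM) semigroup_op_cst.
  have -> : semigroup_op P v (fun y => f y + M) =
      fun y => semigroup_op P v f y + M.
    by apply/funext => y; rewrite (semigroup_opD _ _ bf bM) semigroup_op_cst.
  rewrite (semigroup_opD _ _ (bounded_semigroup_op v bf) bM) semigroup_op_cst.
  exact: addIr.
have mE : measurable_fun [set: X] (fun y => (f y)%:E).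
  by apply/measurable_EFinP; case: bf.
rewrite /semigroup_op /Rintegral; congr fine.
(* In [kcomp] the second kernel may also depend on the starting point; [kernel_snd] lets it see the
   intermediate point only. *)
rewrite (@eq_measure_integral _ _ _ _
  (kcomp (P u) (kernel.kernel_snd (P v)) x)); last first.
  by move=> A mA _; exact: SP.2.
rewrite integral_kcomp//.
apply: eq_integral => y _; rewrite fineK//.
by apply: integrable_fin_num => //; exact: pker_integrable bf.
Qed.

End SemigroupOperators.

(** * Symmetry on a finite closed set *)

Lemma cvg_sum {R : realType} {T : Type} {F : set_system T} {FF : Filter F}
    (I : Type) (r : seq I) (f : I -> T -> R) (l : I -> R) :
  (forall i, f i x @[x --> F] --> l i) ->
  \sum_(i <- r) f i x @[x --> F] --> \sum_(i <- r) l i.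
Proof.
move=> fl; apply: (@cvg_big _ _ _ _ xpredT) => [|i _]; last exact: fl.
exact: pseudometric_normed_Zmodule.add_continuous.
Qed.

Section FiniteSymmetry.
Context {d : measure_display} {X : measurableType d} {R : realType}.
Variable P : R -> R.-pker X ~> X.
Hypothesis SP : transition_semigroup P.
Context {n : nat} (xs : 'I_n -> X) (m : 'I_n -> R).
Hypothesis xs_inj : injective xs.
Hypothesis mxs : forall i, measurable [set xs i].
Implicit Types (f g : X -> R) (M N u h : R).

Let D := range xs.

(** The form [A_u(f, g)] on the points enumerated by [xs]; the weights [m] are arbitrary reals
    here. *)
Definition asymmetry u f g := \sum_i m i *
  (semigroup_op P u f (xs i) * g (xs i) - f (xs i) * semigroup_op P u g (xs i)).

Let p h i j := semigroup_op P h (\1_[set xs j]) (xs i).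
Let q h i := semigroup_op P h (\1_(~` D)) (xs i).

(** The defect of detailed balance between the points at time [h], plus the mass outside [D] counted
    twice, once for [f] and once for [g]. It depends on neither function, which makes the [o(h)]
    bound uniform. *)
Definition imbalance h :=
  \sum_i \sum_j `|m i * p h i j - m j * p h j i| + 2 * \sum_i `|m i| * q h i.

Let mD : measurable (~` D).
Proof.
apply: measurableC; rewrite /D.
have -> : range xs = \bigcup_(i in [set: 'I_n]) [set xs i].
  by apply/seteqP; split => [_ [i _ <-]|x [i _ ->]]; exists i.
exact: fin_bigcup_measurable.
Qed.

Lemma semigroup_op_sum k (c : 'I_k -> R) (F : 'I_k -> X -> R) u x :
  (forall j, bounded_measurable_by 1 (F j)) ->
  (exists M, bounded_measurable_by M (fun y => \sum_j c j * F j y)) /\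
  semigroup_op P u (fun y => \sum_j c j * F j y) x =
  \sum_j c j * semigroup_op P u (F j) x.
Proof.
move=> bF; elim: k c F bF => [|k IH] c F bF.
  have -> : (fun y => \sum_j c j * F j y) = (fun=> 0).
    by apply/funext => y; rewrite big_ord0.
  rewrite big_ord0 semigroup_op_cst; split => //.
  by exists `|0 : R|; exact: bounded_measurable_by_cst.
have [[M bM] E] := IH (fun j => c (lift ord0 j)) (fun j => F (lift ord0 j))
  (fun j => bF _).
have -> : (fun y => \sum_j c j * F j y) = (fun y => c ord0 * F ord0 y +
    \sum_(j < k) c (lift ord0 j) * F (lift ord0 j) y).
  by apply/funext => y; rewrite big_ord_recl.
rewrite big_ord_recl.
have bc := bounded_measurable_byM (bounded_measurable_by_cst (c ord0))
  (bF ord0).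
split; first by eexists; exact: (bounded_measurable_byD bc bM).
by rewrite (semigroup_opD _ _ _ bc bM) (semigroup_opZ _ _ _ _ (bF _)) E.
Qed.

Let remainder h f i :=
  semigroup_op P h (fun y => f y * \1_(~` D) y) (xs i).

(** On [D] the function is a combination of indicators of points, exactly one of them nonzero by
    injectivity. Closedness of [D] will be known for the generator only, so the mass that has left
    [D] by time [h] stays as a remainder. *)
Lemma semigroup_op_split M f h i : bounded_measurable_by M f ->
  semigroup_op P h f (xs i) = \sum_j f (xs j) * p h i j + remainder h f i.
Proof.
move=> bf.
have bI : bounded_measurable_by 1 (\1_(~` D) : X -> R).
  exact: bounded_measurable_by_indic.
have [[N bN] E] := @semigroup_op_sum _ (fun j => f (xs j))
  (fun j => \1_[set xs j]) h (xs i)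
  (fun j => bounded_measurable_by_indic (mxs j)).
rewrite -E /remainder -(semigroup_opD _ _ _ bN (bounded_measurable_byM bf bI)).
congr (semigroup_op _ _ _ _); apply/funext => y.
have [[j _ <-]|yD] := pselect (D y).
  rewrite (bigD1 j)//= indicE mem_set// mulr1 big1 ?addr0; last first.
    move=> k kj; rewrite indicE memNset ?mulr0// => /xs_inj/eqP.
    by rewrite eq_sym (negbTE kj).
  by rewrite indicE memNset ?mulr0 ?addr0//; apply; exists j.
rewrite big1 ?add0r; first by rewrite indicE mem_set// mulr1.
by move=> j _; rewrite indicE memNset ?mulr0// => yj; apply: yD; exists j.
Qed.

Lemma remainder_le M f h i : bounded_measurable_by M f ->
  `|remainder h f i| <= M * q h i.
Proof.
move=> bf; have M0 := bounded_measurable_by_ge0 (xs i) bf.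
have bI : bounded_measurable_by 1 (\1_(~` D) : X -> R).
  exact: bounded_measurable_by_indic.
rewrite /remainder /q -(semigroup_opZ _ _ _ _ bI).
apply: (semigroup_op_norm_le _ _ _ (bounded_measurable_byM bf bI)).
  exact: (bounded_measurable_byM (bounded_measurable_by_cst M) bI).
move=> y; rewrite normrM ler_pM//; first by case: bf.
by rewrite indicE; case: (_ \in _); rewrite ?normr1 ?normr0.
Qed.

Lemma asymmetry_le M N f g h : bounded_measurable_by M f ->
  bounded_measurable_by N g ->
  `|asymmetry h f g| <= M * N * imbalance h.
Proof.
move=> bf bg; have [_ fM] := bf; have [_ gN] := bg.
have -> : asymmetry h f g =
   \sum_i \sum_j (m i * p h i j - m j * p h j i) * (f (xs j) * g (xs i)) +
   \sum_i m i * (remainder h f i * g (xs i) - f (xs i) * remainder h g i).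
  rewrite /asymmetry.
  transitivity (\sum_i \sum_j m i * p h i j * (f (xs j) * g (xs i)) -
     \sum_i \sum_j m i * p h i j * (f (xs i) * g (xs j)) +
     \sum_i m i * (remainder h f i * g (xs i) - f (xs i) * remainder h g i)).
    rewrite -sumrB -big_split/=; apply: eq_bigr => i _.
    rewrite (semigroup_op_split _ _ bf) (semigroup_op_split _ _ bg).
    transitivity (m i * ((\sum_j f (xs j) * p h i j) * g (xs i) -
        f (xs i) * \sum_j g (xs j) * p h i j) +
        m i * (remainder h f i * g (xs i) - f (xs i) * remainder h g i)).
      by ring.
    congr (_ + _); rewrite mulr_suml !mulr_sumr -!sumrB mulr_sumr.
    by apply: eq_bigr => j _; ring.
  (* Relabelling the second double sum pairs [m i * p h i j] with [m j * p h j i] in front of the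
     same product of values. *)
  congr (_ + _); rewrite [X in _ - X]exchange_big/= -sumrB.
  apply: eq_bigr => i _; rewrite -sumrB; apply: eq_bigr => j _.
  by ring.
rewrite (le_trans (ler_normD _ _))// /imbalance [leRHS]mulrDr lerD//.
  rewrite (le_trans (ler_norm_sum _ _ _))// mulr_sumr ler_sum// => i _.
  rewrite (le_trans (ler_norm_sum _ _ _))// mulr_sumr ler_sum// => j _.
  by rewrite normrM mulrC ler_wpM2r// normrM ler_pM.
rewrite (le_trans (ler_norm_sum _ _ _))// !mulr_sumr ler_sum// => i _.
rewrite normrM.
have -> : M * N * (2 * (`|m i| * q h i)) = `|m i| * (2 * (M * N * q h i)).
  by ring.
rewrite ler_wpM2l//.
rewrite (le_trans (ler_normB _ _))// !normrM.
have -> : 2 * (M * N * q h i) = (M * q h i) * N + M * (N * q h i) by ring.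
by rewrite lerD// ler_pM//; exact: remainder_le.
Qed.

(** Writing [P_(u+h) f] as [P_u (P_h f)] and [P_(u+h) g] as [P_h (P_u g)], the terms with
    [P_h f * P_u g] cancel on the right. *)
Lemma asymmetryS M N f g u h : 0 <= u -> 0 <= h ->
  bounded_measurable_by M f -> bounded_measurable_by N g ->
  asymmetry (u + h) f g =
  asymmetry u (semigroup_op P h f) g + asymmetry h f (semigroup_op P u g).
Proof.
move=> u0 h0 bf bg; rewrite /asymmetry -big_split/=; apply: eq_bigr => i _.
rewrite (semigroup_op_comp SP _ u0 h0 bf) (addrC u h).
rewrite (semigroup_op_comp SP _ h0 u0 bg).
by rewrite -mulrDr; congr (_ * _); ring.
Qed.

(** Each step of length [h] costs one [imbalance h]. The induction is over all [f], since a step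
    replaces [f] by [P_h f], which has the same bound. *)
Lemma asymmetry_natmul_le M N f g h k : 0 <= h -> bounded_measurable_by M f ->
  bounded_measurable_by N g ->
  `|asymmetry (k%:R * h) f g| <= k%:R * (M * N * imbalance h).
Proof.
move=> h0 + bg; elim: k f => [|k IH] f bf.
  rewrite !mul0r /asymmetry big1 ?normr0// => i _.
  by rewrite !(semigroup_op0 SP)// ?subrr ?mulr0//; [case: bg|case: bf].
rewrite -natr1 !mulrDl !mul1r (asymmetryS _ h0 bf bg) ?mulr_ge0//.
rewrite (le_trans (ler_normD _ _))// lerD//.
  by apply: IH; exact: bounded_semigroup_op.
by apply: asymmetry_le => //; exact: bounded_semigroup_op.
Qed.

Variable L : (X -> R) -> X -> R.
Hypothesis GP : has_generator P L.
Hypothesis detailed_balance : forall i j,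
  m i * L (\1_[set xs j]) (xs i) = m j * L (\1_[set xs i]) (xs j).
Hypothesis closedD : forall i, L (\1_(~` D)) (xs i) = 0.

(** After division by [h] the entries become finitely many difference quotients; their limits are
    values of [L] on indicators, which cancel by detailed balance or vanish by closedness. *)
Lemma imbalance_cvg0 : imbalance h / h @[h --> 0^'+] --> (0 : R).
Proof.
have bi A : measurable A -> bounded_measurable (\1_A : X -> R).
  move=> mA; apply/bounded_measurableP; exists 1.
  exact: bounded_measurable_by_indic.
pose dp h i j := (p h i j - \1_[set xs j] (xs i)) / h.
pose dq h i := q h i / h.
have dp_cvg i j : dp h i j @[h --> 0^'+] --> L (\1_[set xs j]) (xs i).
  by apply: GP; exact: bi.
have dq_cvg i : dq h i @[h --> 0^'+] --> (0 : R).
  have : (q h i - \1_(~` D) (xs i)) / h @[h --> 0^'+] --> L (\1_(~` D)) (xs i).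
    by apply: GP; exact: bi.
  rewrite closedD indicE memNset; last by apply; exists i.
  by under eq_fun do rewrite subr0.
(* The time-zero terms of the difference quotients are symmetric in [i] and [j], hence drop out of
   the antisymmetric combination. *)
have indC i j : m i * \1_[set xs j] (xs i) = m j * \1_[set xs i] (xs j) :> R.
  rewrite !indicE; have [->//|ij] := eqVneq i j.
  rewrite !memNset ?mulr0// => /xs_inj/eqP; rewrite ?(negbTE ij)//.
  by rewrite eq_sym (negbTE ij).
have E : {near (0 : R)^'+, (fun h =>
    \sum_i \sum_j `|m i * dp h i j - m j * dp h j i| +
    2 * \sum_i `|m i| * dq h i) =1 (fun h => imbalance h / h)}.
  near=> h; have h0 : 0 < h by near: h; exact: nbhs_right_gt.
  rewrite /imbalance /= [RHS]mulrDl mulr_suml; congr (_ + _).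
    apply: eq_bigr => i _; rewrite mulr_suml; apply: eq_bigr => j _.
    have -> : m i * dp h i j - m j * dp h j i =
        (m i * p h i j - m j * p h j i) / h.
      transitivity ((m i * p h i j - m j * p h j i) / h -
        (m i * \1_[set xs j] (xs i) - m j * \1_[set xs i] (xs j)) / h).
        by rewrite /dp; ring.
      by rewrite indC subrr mul0r subr0.
    by rewrite normrM normfV (gtr0_norm h0).
  rewrite -mulrA; congr (_ * _); rewrite mulr_suml; apply: eq_bigr => i _.
  by rewrite mulrA.
apply: cvg_trans (near_eq_cvg E) _.
have S0 : \sum_i \sum_j
    `|m i * L (\1_[set xs j]) (xs i) - m j * L (\1_[set xs i]) (xs j)| +
    2 * \sum_i `|m i| * 0 = 0 :> R.
  rewrite [X in 2 * X]big1 ?mulr0 ?addr0; last by move=> i _; rewrite mulr0.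
  rewrite big1// => i _; rewrite big1// => j _.
  by rewrite detailed_balance subrr normr0.
have c1 i j : `|m i * dp h i j - m j * dp h j i| @[h --> 0^'+] -->
    `|m i * L (\1_[set xs j]) (xs i) - m j * L (\1_[set xs i]) (xs j)|.
  exact: (cvg_norm (cvgB (cvgM (cvg_cst (m i)) (dp_cvg i j))
    (cvgM (cvg_cst (m j)) (dp_cvg j i)))).
have c2 i : `|m i| * dq h i @[h --> 0^'+] --> `|m i| * 0.
  by apply: cvgM; [exact: cvg_cst|exact: dq_cvg].
have C1 := cvg_sum (r := index_enum _)
  (fun i => cvg_sum (r := index_enum _) (c1 i)).
have C2 := cvg_sum (r := index_enum _) c2.
have := cvgD (C1 _ _) (cvgM (cvg_cst (2 : R)) (C2 _)).
by rewrite S0; exact.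
Unshelve. all: by end_near. Qed.

Lemma asymmetry0 M N f g u : 0 <= u ->
  bounded_measurable_by M f -> bounded_measurable_by N g ->
  asymmetry u f g = 0.
Proof.
move=> u0 bf bg.
have [i0|n0] := pselect (exists i : 'I_n, True); last first.
  by rewrite /asymmetry big1// => i; exfalso; apply: n0; exists i.
move: u0; rewrite le_eqVlt => /predU1P[<-|u0].
  rewrite /asymmetry big1// => i _.
  by rewrite !(semigroup_op0 SP)// ?subrr ?mulr0//; [case: bg|case: bf].
pose t k : R := u / k.+1%:R.
have t0 k : 0 < t k by rewrite divr_gt0.
have tcvg : t k @[k --> \oo] --> (0 : R).
  rewrite -(mulr0 u); apply: cvgM; first exact: cvg_cst.
  exact: cvg_harmonic.
have /cvg_at_rightP/(_ t (conj t0 tcvg)) := imbalance_cvg0.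
(* Since [u = k.+1 * t k], the bound [k.+1 * (M * N * imbalance (t k))] is [M * N * u] times
   [imbalance (t k) / t k]. *)
move=> /(cvgM (cvg_cst (M * N * u))); rewrite mulr0 => h.
apply/eqP; rewrite -normr_le0.
apply: (ler_cvg_to (cvg_cst _) h).
apply: nearW => k /=.
have uE : u = k.+1%:R * t k by rewrite /t mulrCA divff ?mulr1.
rewrite {1}uE (le_trans (asymmetry_natmul_le _ (ltW (t0 k)) bf bg))//.
rewrite [X in _ <= M * N * X * _]uE le_eqVlt; apply/orP; left; apply/eqP.
by field; rewrite gt_eqF.
Qed.

End FiniteSymmetry.

(** * Detailed balance and reversibility *)

Lemma integral_range {d} {X : measurableType d} {R : realType}
    (mu : {measure set X -> \bar R}) {n : nat} (xs : 'I_n -> X) (f : X -> R) :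
  (mu [set: X] < +oo)%E -> injective xs ->
  (forall i, measurable [set xs i]) -> measurable_fun [set: X] f ->
  (\int[mu]_(x in range xs) (f x)%:E)%E =
  (\sum_i fine (mu [set xs i]) * f (xs i))%:E.
Proof.
move=> mu_fin xs_inj mxs mf.
have mx_fin i : mu [set xs i] \is a fin_num.
  rewrite ge0_fin_numE//; apply: le_lt_trans mu_fin.
  by apply: le_measure; rewrite ?inE.
have -> : range xs = \big[setU/set0]_(i <- index_enum 'I_n) [set xs i].
  rewrite -bigcup_seq; apply/seteqP; split => [_ [i _ <-]|x [i _ ->]].
    by exists i => //=; rewrite mem_index_enum.
  by exists i.
rewrite (@integral_bigsetU_EFin _ _ _ mu)//; last 3 first.
- exact: index_enum_uniq.
- by move=> i j _ _ [x [-> /= /xs_inj]].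
- by apply: measurable_funTS; apply/measurable_EFinP.
rewrite -sumEFin; apply: eq_bigr => i _.
rewrite (eq_integral (cst (f (xs i))%:E)); last by move=> x /[1!inE] /= ->.
by rewrite integral_cst// EFinM fineK // muleC.
Qed.

(** The difference of the two integrands is bounded and [mu] is finite, so its integral is the sum
    over the blocks; on each block it is the [asymmetry] weighted by the point masses, which
    vanishes. *)
Lemma reversible_of_blocks {d} {X : measurableType d} {R : realType}
    (P : R -> R.-pker X ~> X) (L : (X -> R) -> X -> R)
    (mu : {measure set X -> \bar R})
    (n : nat -> nat) (xs : forall N, 'I_(n N) -> X) :
  transition_semigroup P -> has_generator P L -> (mu [set: X] < +oo)%E ->
  (forall N, injective (xs N)) -> (forall x : X, measurable [set x]) ->
  trivIset [set: nat] (fun N => range (xs N)) ->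
  \bigcup_N range (xs N) = [set: X] ->
  (forall N i, L (\1_(~` range (xs N))) (xs N i) = 0) ->
  (forall N i j,
    fine (mu [set xs N i]) * L (\1_[set xs N j]) (xs N i) =
    fine (mu [set xs N j]) * L (\1_[set xs N i]) (xs N j)) ->
  reversible mu P.
Proof.
move=> SP GP mu_fin xs_inj mX txs cover closed balance u f g u0.
move=> /bounded_measurableP[M bf] /bounded_measurableP[N bg].
have int h C : bounded_measurable_by C h -> mu.-integrable [set: X] (EFin \o h).
  move=> bh; have [mh bh'] : bounded_measurable h.
    by apply/bounded_measurableP; exists C.
  by apply: measurable_bounded_integrable.
have bPf := bounded_semigroup_op P u bf.
have bPg := bounded_semigroup_op P u bg.
have b1 := bounded_measurable_byM bf bPg.
have b2 := bounded_measurable_byM bPf bg.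
have i1 := int _ _ b1; have i2 := int _ _ b2.
apply/eqP; rewrite eq_sym -subr_eq0 -RintegralB//; apply/eqP.
rewrite /Rintegral -cover integral_bigcup//; last 2 first.
- move=> k.
  have -> : range (xs k) = \bigcup_(i in [set: 'I_(n k)]) [set xs k i].
    by apply/seteqP; split => [_ [i _ <-]|x [i _ ->]]; exists i.
  by apply: fin_bigcup_measurable.
- rewrite cover; apply: (integrableB _ i2 i1) => //.
rewrite eseries0// => k _ _.
rewrite integral_range//; last first.
  by apply: measurable_funB; [case: b2|case: b1].
congr EFin.
exact: (asymmetry0 SP (xs_inj k) (fun i => mX (xs k i)) GP (balance k)
  (closed k) u0 bf bg).
Qed.

(** * The levels [n + m = N] *)

Definition level N (i : 'I_N.+1) : nat * nat := (nat_of_ord i, (N - i)%N).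

Lemma level_inj N : injective (@level N).
Proof. by move=> i j [/ord_inj]. Qed.

Lemma range_level N : range (@level N) = [set x | (x.1 + x.2)%N = N].
Proof.
apply/seteqP; split => [_ [i _ <-]/=|[n m]/= nm].
  by rewrite subnKC// -ltnS.
have nN : (n < N.+1)%N by rewrite ltnS -nm leq_addr.
by exists (Ordinal nN) => //; rewrite /level/= -nm addKn.
Qed.

(** Every jump preserves the total, so the indicator of the complement is 0 at both of its ends. *)
Lemma generator_level_closed {R : realType} (s t : R) N (i : 'I_N.+1) :
  generator s t (\1_(~` range (@level N)) : nat * nat -> R) (level i) = 0.
Proof.
rewrite range_level /=; have := ltn_ord i; rewrite ltnS => iN.
rewrite big1// => k _; rewrite big1// => l _.
have := ltn_ord k; have := ltn_ord l; rewrite !ltnS => lN ki.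
by rewrite !indicE !memNset ?subrr ?mulr0//=; apply; lia.
Qed.

(** * Detailed balance for the exchange rates *)

Section BetaBinomialExchange.
Context {R : realType}.
Variables (s t theta : R).
Hypotheses (s0 : 0 < s) (t0 : 0 < t) (theta01 : 0 < theta < 1).

(* The stationary flow along the exchange of [k] against [l] depends only on
   [(k, n - k, l, m - l)], symmetrically in [k] and [l]. *)
Definition exchange_weight (k p l q : nat) : R :=
  Gamma (k%:R + s) * Gamma (l%:R + s) * (Gamma (p%:R + t) * Gamma (q%:R + t)) /
    (k`!%:R * l`!%:R * (p`!%:R * q`!%:R)).

Lemma exchange_weightC k p l q :
  exchange_weight k p l q = exchange_weight l p k q.
Proof. by rewrite /exchange_weight; congr (_ / _); ring. Qed.

(** The part of the flow that depends on the total only; the square comes from one normalisation per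
    coordinate. *)
Definition exchange_const N : R :=
  (((1 - theta) `^ (- (s + t)))^-1 / (Gamma (s + t) * Beta s t)) ^+ 2 *
  theta ^+ N.

Local Notation pmf := (discrete_gamma_pmf (s + t) theta).

(** The factorials of [n] and [m] and the values [Gamma (s + t + n)] and [Gamma (s + t + m)] cancel
    between the weights and the rate. *)
Lemma pmf_rate n m k l : (k <= n)%N -> (l <= m)%N ->
  pmf n * pmf m * rate s t n m k l =
  exchange_const (n + m) * exchange_weight k (n - k) l (m - l).
Proof.
move=> kn lm.
rewrite /discrete_gamma_pmf /rate /exchange_const /exchange_weight.
have G0 x : 0 < x -> Gamma x != 0 by move=> /Gamma_gt0 Gx; rewrite gt_eqF.
have st0 : 0 < s + t by rewrite addr_gt0.
have gn : Gamma (s + t + n%:R) != 0 by rewrite G0// ltr_wpDr.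
have gm : Gamma (s + t + m%:R) != 0 by rewrite G0// ltr_wpDr.
have g0 : Gamma (s + t) != 0 by rewrite G0.
have b0 : Beta s t != 0.
  by apply: lt0r_neq0; apply: divr_gt0; [apply: mulr_gt0|]; exact: Gamma_gt0.
have f0 j : j`!%:R != 0 :> R by rewrite pnatr_eq0 -lt0n fact_gt0.
have z0 : (1 - theta) `^ (- (s + t)) != 0.
  by rewrite gt_eqF// powR_gt0// subr_gt0; case/andP: theta01.
rewrite exprD; move: gn gm g0 b0 z0.
move: (f0 n) (f0 m) (f0 k) (f0 (n - k)%N) (f0 l) (f0 (m - l)%N).
(* [field] would otherwise try to unfold [Gamma] when comparing atoms. *)
move: (Gamma (s + t + n%:R)) (Gamma (s + t + m%:R)) (Gamma (s + t)) (Beta s t).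
move: ((1 - theta) `^ (- (s + t))) (Gamma (k%:R + s)) (Gamma (l%:R + s)).
move: (Gamma ((n - k)%:R + t)) (Gamma ((m - l)%:R + t)).
move: (n`!%:R : R) (m`!%:R : R) (k`!%:R : R) ((n - k)`!%:R : R) (l`!%:R : R).
move: ((m - l)`!%:R : R) (theta ^+ n) (theta ^+ m).
move=> *; field; do ?[apply/andP; split] => //.
Qed.

Let flow N (i k l : 'I_N.+1) : R :=
  exchange_const N * exchange_weight k (i - k) l (N - i - l).

(** A triple [(i, (k, l))] encodes a jump from [level i]. All indices live in one ordinal type, so
    that reversing jumps acts on a fixed finite type; [valid] restores the ranges [k <= n] and
    [l <= m]. *)
Let valid N (x : 'I_N.+1 * ('I_N.+1 * 'I_N.+1)) :=
  (x.2.1 <= x.1)%N && (x.2.2 <= N - x.1)%N.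

(** The reversed jump: it starts at the target and exchanges [k] and [l]. On valid triples the
    argument of [inord] is in range, so its default value does not occur. *)
Let swap N (x : 'I_N.+1 * ('I_N.+1 * 'I_N.+1)) :
    'I_N.+1 * ('I_N.+1 * 'I_N.+1) :=
  (inord (x.1 - x.2.1 + x.2.2), (x.2.2, x.2.1)).

Let swap1 N x : @valid N x -> (swap x).1 = (x.1 - x.2.1 + x.2.2)%N :> nat.
Proof.
case: x => i [k l]; rewrite /valid/= => /andP[ki lN].
rewrite inordK// ltnS; have := ltn_ord i; rewrite ltnS => iN; lia.
Qed.

Let swap_valid N x : @valid N x -> valid (swap x).
Proof.
move=> vx; have := swap1 vx; move: vx; case: x => i [k l].
rewrite /valid/= => /andP[ki lN] ->.
have := ltn_ord i; rewrite ltnS => iN; lia.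
Qed.

Let swapK N x : @valid N x -> swap (swap x) = x.
Proof.
move=> vx; have h1 := swap1 vx; have h2 := swap1 (swap_valid vx).
move: vx h1 h2; case: x => i [k l]; rewrite /valid/= => /andP[ki lN] h1 h2.
congr (_, (_, _)); apply/ord_inj; rewrite [LHS]h2 /= h1.
have := ltn_ord i; rewrite ltnS => iN; lia.
Qed.

(** Reversal keeps [n - k] and [m - l] and exchanges [k] with [l], so this is the symmetry of
    [exchange_weight]. *)
Let flow_swap N x : @valid N x ->
  flow (swap x).1 (swap x).2.1 (swap x).2.2 = flow x.1 x.2.1 x.2.2.
Proof.
move=> vx; rewrite /flow (swap1 vx); move: vx; case: x => i [k l].
rewrite /valid/= => /andP[ki lN]; rewrite exchange_weightC.
have := ltn_ord i; rewrite ltnS => iN.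
have -> : (i - k + l - l = i - k)%N by lia.
by have -> : (N - (i - k + l) - k = N - i - l)%N by lia.
Qed.

(** The weighted product of [g] with the generator of [f] becomes a single sum over the jumps of the
    level, ready for reindexing by [swap]. *)
Lemma generator_form N (f g : nat * nat -> R) :
  \sum_i pmf (@level N i).1 * pmf (level i).2 * g (level i) *
    generator s t f (level i) =
  \sum_(x | @valid N x) flow x.1 x.2.1 x.2.2 * g (level x.1) *
    (f (level (swap x).1) - f (level x.1)).
Proof.
transitivity (\sum_(i < N.+1) \sum_(x : 'I_N.+1 * 'I_N.+1 | valid (i, x))
    flow i x.1 x.2 * g (level i) * (f (level (swap (i, x)).1) - f (level i))).
  apply: eq_bigr => i _; have := ltn_ord i; rewrite ltnS => iN.
  rewrite [LHS]/=.
  transitivity (\sum_(k < N.+1 | (k <= i)%N) \sum_(l < N.+1 | (l <= N - i)%N)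
    flow i k l * g (level i) *
      (f (level (swap (i, (k, l))).1) - f (level i))); last first.
    by rewrite pair_big_dep; apply: eq_bigl => -[].
  (* The state-dependent ranges of [k] and [l] are widened to [N.+1], the old bounds becoming
     filters. *)
  rewrite (big_ord_widen N.+1 (fun k => \sum_(l < (N - i).+1)
     rate s t i (N - i) k l *
     (f ((i - k + l)%N, (N - i - l + k)%N) - f (nat_of_ord i, (N - i)%N))))//.
  rewrite mulr_sumr; apply: eq_bigr => k; rewrite ltnS => ki.
  rewrite (big_ord_widen N.+1 (fun l => rate s t i (N - i) k l *
     (f ((i - k + l)%N, (N - i - l + k)%N) - f (nat_of_ord i, (N - i)%N))));
    last by rewrite ltnS leq_subr.
  rewrite mulr_sumr; apply: eq_bigr => l; rewrite ltnS => lN.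
  have v : valid (i, (k, l)) by rewrite /valid/= ki lN.
  rewrite mulrA [_ * rate _ _ _ _ _ _]mulrAC pmf_rate// subnKC//.
  congr (_ * (f _ - _)).
  rewrite /level [X in (_, X)](_ : _ = N - (swap (i, (k, l))).1)%N.
    by rewrite (swap1 v).
  by rewrite (swap1 v)/=; lia.
by rewrite pair_big_dep; apply: eq_bigl => -[].
Qed.

(** The loss terms are symmetric in [f] and [g] as they stand. In the gain terms [g] is taken at the
    start of a jump and [f] at its end, and the involution [swap] exchanges the two while preserving
    the flow. *)
Lemma generator_formC N (f g : nat * nat -> R) :
  \sum_i pmf (@level N i).1 * pmf (level i).2 * g (level i) *
    generator s t f (level i) =
  \sum_i pmf (@level N i).1 * pmf (level i).2 * f (level i) *
    generator s t g (level i).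
Proof.
rewrite !generator_form.
under eq_bigr do rewrite mulrBr; under [RHS]eq_bigr do rewrite mulrBr.
rewrite !sumrB; congr (_ - _); last first.
  by apply: eq_bigr => x _; rewrite mulrAC.
rewrite (reindex_onto (@swap N) (@swap N)); last exact: swapK.
apply: eq_big => [x|x /andP[vx /eqP sx]].
  apply/andP/idP => [[vx /eqP <-]|vx]; first exact: swap_valid.
  by rewrite swap_valid// swapK.
have v : valid x by rewrite -sx swap_valid.
by rewrite sx flow_swap// mulrAC.
Qed.

(** The symmetric form, tested on two indicators of points, yields the entries of the rate
    matrix. *)
Lemma generator_detailed_balance N (i j : 'I_N.+1) :
  pmf (level i).1 * pmf (level i).2 *
    generator s t (\1_[set level j]) (level i) =
  pmf (level j).1 * pmf (level j).2 *
    generator s t (\1_[set level i]) (level j).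
Proof.
have pick k (F : 'I_N.+1 -> R) :
    \sum_l F l * \1_[set level k] (level l) = F k.
  rewrite (bigD1 k)//= indicE mem_set// mulr1 big1 ?addr0// => l lk.
  rewrite indicE memNset ?mulr0// => /level_inj/eqP.
  by rewrite (negbTE lk).
have := generator_formC N (\1_[set level j]) (\1_[set level i]).
under eq_bigr do rewrite mulrAC; rewrite pick => ->.
by under eq_bigr do rewrite mulrAC; rewrite pick.
Qed.

End BetaBinomialExchange.

Theorem proposition5p1 (R : realType) (s t : R) (hs : 0 < s) (ht : 0 < t)
    (theta : R) (htheta : 0 < theta < 1) :
  exists nu : probability nat R,
    (forall n : nat, nu [set n] = (discrete_gamma_pmf (s + t) theta n)%:E) /\
    (forall P : R -> R.-pker (nat * nat)%type ~> (nat * nat)%type,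
       transition_semigroup P -> has_generator P (generator s t) ->
       reversible (nu \x nu)%E P).
Proof.
have a0 : 0 < s + t by rewrite addr_gt0.
have [nu nuE] := probability_of_pmf
  (fun n => discrete_gamma_pmf_ge0 n a0 htheta)
  (discrete_gamma_pmf_sum a0 htheta).
exists nu; split=> // P SP GP.
have set1E (x : nat * nat) : [set x] = [set x.1] `*` [set x.2].
  by case: x => n m; apply/seteqP; split => [_ ->|[a b] [/= -> ->]].
have nuE2 (x : nat * nat) : fine ((nu \x nu)%E [set x]) =
    discrete_gamma_pmf (s + t) theta x.1 * discrete_gamma_pmf (s + t) theta x.2.
  rewrite set1E product_measure1E// -[RHS]/(fine (_%:E * _%:E)%E).
  by congr (fine (_ * _)%E); exact: nuE.
have muT : ((nu \x nu)%E [set: nat * nat] < +oo)%E.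
  by rewrite -setXTT product_measure1E// ltey_eq fin_numM// fin_num_measure.
(* The blocks are the levels; level [N] has [N + 1] points, hence [succn]. *)
apply: (@reversible_of_blocks _ _ R P (generator s t) (nu \x nu)%E succn level
  SP GP).
- exact: muT.
- exact: level_inj.
- by move=> x; rewrite set1E; exact: measurableX.
- move=> N N' _ _ [x []]; rewrite !range_level /= => -> //.
- apply/seteqP; split => // x _.
  by exists (x.1 + x.2)%N => //; rewrite range_level.
- by move=> N i; exact: generator_level_closed.
- by move=> N i j; rewrite !nuE2; exact: generator_detailed_balance.
Qed.
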